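(* Let $1\le r<n$ be integers, let $\phi\in\operatorname{Aut}(G_{n,r})$, and let $\varphi:\mathfrak C_{n,r}\to\mathfrak C_{n,r}$ be the Rubin conjugator representing $\phi$. Then the set $$\mathcal{LA}_\varphi=\{f:\mathfrak C_n\to\mathfrak C_n \mid \exists\,\nu\in W_{n,r},\ f=\varphi_\nu\}$$ of local actions of $\varphi$ is finite.
   Context: $X_n=\{0,\dots,n-1\}$; $\dot{\mathbf r}$ is a set of $r$ symbols disjoint from $X_n$; $\mathfrak C_n=X_n^\omega$ and $\mathfrak C_{n,r}=\{ca_1a_2\ldots: c\in\dot{\mathbf r},a_i\in X_n\}$ with product topologies. $W_{n,r,\varepsilon}$ is the set of finite words $ca_1\ldots a_k$ with $c\in\dot{\mathbf r}$, $a_i\in X_n$, $k\ge0$, and $W_{n,r}\subset W_{n,r,\varepsilon}$ is the subset of those with $k\ge1$. For $\eta\in W_{n,r,\varepsilon}$, $U_\eta=\{\eta x:x\in\mathfrak C_n\}$. Maps are written on the right. $G_{n,r}$ (Higman--Thompson group) is the group of homeomorphisms $g$ of $\mathfrak C_{n,r}$ for which there are complete antichains (finite maximal sets of pairwise prefix-incomparable words of $W_{n,r,\varepsilon}$) $\{\eta_i\}_{i<k}$, $\{\zeta_i\}_{i<k}$ with $(\eta_ix)g=\zeta_ix$ for all $i<k$, $x\in\mathfrak C_n$. Rubin conjugator: for each $\phi\in\operatorname{Aut}(G_{n,r})$ there is, by Rubin's theorem, a (unique) homeomorphism $\varphi$ of $\mathfrak C_{n,r}$ with $g\phi=\varphi^{-1}g\varphi$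 for all $g\in G_{n,r}$. Local actions: for a homeomorphism $h$ of $\mathfrak C_{n,r}$ and $\nu\in W_{n,r,\varepsilon}$, let $\nu\theta_h$ be the longest common prefix of all points of $U_\nu h$. The local action of $h$ at $\nu$ is the map $h_\nu$ on $\mathfrak C_n$ defined by $(\nu x)h=(\nu\theta_h)(x h_\nu)$ (concatenation). It takes values in $\mathfrak C_n$ if $\nu\theta_h$ is nonempty and in $\mathfrak C_{n,r}$ if $\nu\theta_h$ is empty. *)

(* Defs.v *)
From HB Require Import structures.
From mathcomp Require Import all_boot.
From mathcomp Require Import all_classical topology.

Set Implicit Arguments.
Unset Strict Implicit.
Unset Printing Implicit Defensive.

Local Open Scope classical_set_scope.

(** Homeomorphisms act on the right: [f * g] is "first [f], then [g]". *)

Section Homeo.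
Variable T : topologicalType.

Record homeo := Homeo {
  hfun :> T -> T;
  hinv : T -> T;
  hfunK : cancel hfun hinv;
  hinvK : cancel hinv hfun;
  hfun_continuous : continuous hfun;
  hinv_continuous : continuous hinv
}.

Lemma homeo_eq (f g : homeo) : hfun f =1 hfun g -> f = g.
Proof.
case: f g => [f f' fK f'K fc f'c] [g g' gK g'K gc g'c] /= /funext efg.
subst g.
have e' : f' = g' by apply/funext => x; rewrite -{1}(g'K x) fK.
by subst g'; f_equal; exact: Prop_irrelevance.
Qed.

HB.instance Definition _ := gen_eqMixin homeo.
HB.instance Definition _ := gen_choiceMixin homeo.

Definition homeo_one : homeo :=
  @Homeo id id (fun _ => erefl) (fun _ => erefl)
    (fun _ _ => id) (fun _ _ => id).

Definition homeo_inv (f : homeo) : homeo :=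
  Homeo (hinvK f) (hfunK f) (@hinv_continuous f) (@hfun_continuous f).

Definition homeo_mul (f g : homeo) : homeo :=
  @Homeo (hfun g \o hfun f) (hinv f \o hinv g)
    (can_comp (hfunK g) (hfunK f)) (can_comp (hinvK f) (hinvK g))
    (fun x => continuous_comp (@hfun_continuous f x) (@hfun_continuous g _))
    (fun x => continuous_comp (@hinv_continuous g x) (@hinv_continuous f _)).

Fact homeo_mulA : associative homeo_mul.
Proof. by move=> f g h; apply: homeo_eq. Qed.
Fact homeo_mul1 : left_id homeo_one homeo_mul.
Proof. by move=> f; apply: homeo_eq. Qed.
Fact homeo_mulr1 : right_id homeo_one homeo_mul.
Proof. by move=> f; apply: homeo_eq. Qed.
Fact homeo_mulV : left_inverse homeo_one homeo_inv homeo_mul.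
Proof. by move=> f; apply: homeo_eq => x /=; rewrite hinvK. Qed.
Fact homeo_mulrV : right_inverse homeo_one homeo_inv homeo_mul.
Proof. by move=> f; apply: homeo_eq => x /=; rewrite hfunK. Qed.

HB.instance Definition _ := isGroup.Build homeo
  homeo_mulA homeo_mul1 homeo_mulr1 homeo_mulV homeo_mulrV.

End Homeo.

(** For a subgroup [A] of a group [gT], an automorphism of [A] is given by a
    map on [gT] whose values outside [A] are irrelevant. *)
Definition automorphism (gT : groupType) (A : set gT) (phi : gT -> gT) : Prop :=
  set_bij A A phi /\ {in A &, {morph phi : g h / (g * h)%g}}.

Section CantorSpaces.
Variables n r : nat.

Definition cantor := prod_topology (fun _ : nat => discrete_topology 'I_n).

(** The point c a_1 a_2 ... is the pair of c and (a_1, a_2, ...), so the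
    alphabets ['I_r] and ['I_n] are kept disjoint by typing. *)
Definition cantorr := (discrete_topology 'I_r * cantor)%type.

(** W_{n,r,eps}: the word c a_1 ... a_k, k >= 0, is the pair of c and
    [:: a_1; ...; a_k]. *)
Definition word := ('I_r * seq 'I_n)%type.

(** W_{n,r}: words with k >= 1. *)
Definition long_word : set word := [set nu | nu.2 != [::]].

Definition wprefix (u v : word) : bool := (u.1 == v.1) && prefix u.2 v.2.

(** The default of [nth] is the value taken when [i >= size s]. *)
Definition append (s : seq 'I_n) (x : cantor) : cantor :=
  fun i => nth (x (i - size s)) s i.

Definition point (u : word) (x : cantor) : cantorr := (u.1, append u.2 x).

Definition cone (u : word) : set cantorr := range (point u).

Definition antichain (A : set word) : Prop :=
  forall u v, A u -> A v -> u <> v -> ~~ wprefix u v.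

Definition complete_antichain (A : set word) : Prop :=
  [/\ finite_set A, antichain A &
      forall B, antichain B -> A `<=` B -> B = A].

Definition higman_thompson : set (homeo cantorr) :=
  [set g | exists k : nat, exists eta zeta : 'I_k -> word,
    [/\ injective eta, injective zeta,
        complete_antichain (range eta), complete_antichain (range zeta) &
        forall i x, g (point (eta i) x) = point (zeta i) x]].

Definition rubin_conjugator (phi : homeo cantorr -> homeo cantorr)
    (varphi : homeo cantorr) : Prop :=
  forall g, higman_thompson g -> phi g = (varphi^-1 * g * varphi)%g.

(** Finite prefixes of points: [None] is the empty word, which is not in
    W_{n,r,eps}. *)
Definition oprefix (p : option word) (z : cantorr) : Prop :=
  if p is Some u then cone u z else True.

Definition olength (p : option word) : nat :=
  if p is Some u then (size u.2).+1 else 0.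

Definition is_lcp (S : set cantorr) (p : option word) : Prop :=
  (forall z, S z -> oprefix p z) /\
  (forall q, (forall z, S z -> oprefix q z) -> olength q <= olength p).

(** [None] is also the junk value when there is no longest common prefix, which
    does not happen when [1 < n]: see [thetaP]. *)
Definition theta (h : homeo cantorr) (nu : word) : option word :=
  xget None [set p | is_lcp (h @` cone nu) p].

(** The map x |-> h_nu(x) obtained from (nu x)h by deleting the prefix
    [theta h nu]; its codomain depends on whether that prefix is empty. *)
Definition local_action (h : homeo cantorr) (nu : word) :
    (cantor -> cantor) + (cantor -> cantorr) :=
  match theta h nu with
  | Some u => inl (fun x i => (h (point nu x)).2 (size u.2 + i))
  | None => inr (fun x => h (point nu x))
  end.

Definition local_actions (h : homeo cantorr) : set (cantor -> cantor) :=
  [set f | exists2 nu, long_word nu & local_action h nu = inl f].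

(** Longest common prefixes exist and are unique, and local
    actions satisfy (nu x)h = (nu theta_h)(x h_nu). *)

Lemma nth_append x0 (s : seq 'I_n) (x : cantor) i :
  i < size s -> append s x i = nth x0 s i.
Proof. by move=> si; rewrite /append; apply: set_nth_default. Qed.

Lemma append_shift (s : seq 'I_n) (x : cantor) i : append s x (size s + i) = x i.
Proof. by rewrite /append nth_default ?leq_addr// addnC addnK. Qed.

Lemma lcp_uniq (S : set cantorr) p q :
  S !=set0 -> is_lcp S p -> is_lcp S q -> p = q.
Proof.
move=> [z Sz] [Sp lp] [Sq lq].
have epq : olength p = olength q.
  by apply/eqP; rewrite eqn_leq lq // lp.
move: (Sp _ Sz) (Sq _ Sz) epq.
case: p {Sp lp} => [[c s]|]; case: q {Sq lq} => [[d t]|] //=.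
move=> [x _ <-] [y _ []] /= <- e [est]; congr (Some (_, _)).
apply: (@eq_from_nth _ (x 0)) => // i si.
by rewrite -(nth_append _ x)// -e (nth_append (x 0))// -est.
Qed.

Lemma lcp_exists (S : set cantorr) (z1 z2 : cantorr) :
  S z1 -> S z2 -> z1 <> z2 -> exists p, is_lcp S p.
Proof.
move=> S1 S2 ne.
pose P k := `[< exists p, (forall z, S z -> oprefix p z) /\ olength p = k >].
have exP : exists k, P k by exists 0; apply/asboolP; exists None.
have [K KP] : exists K, forall k, P k -> k <= K.
  have [ee1|/eqP e1] := eqVneq z1.1 z2.1; last first.
    exists 0 => k /asboolP[[u|] [up <-]] //.
    by have [x _ ex] := up _ S1; have [y _ ey] := up _ S2; case: e1; rewrite -ex -ey.
  have [j /eqP zj] : exists j, z1.2 j <> z2.2 j.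
    apply: contrapT => /forallNP no; apply: ne.
    by move: ee1 no; case: (z1) (z2) => [c x] [d y] /= -> no; congr (_, _);
       apply/funext => j; apply: contrapT; exact: no.
  exists j.+1 => k /asboolP[[u|] [up <-]] //=.
  have [x _ ex] := up _ S1; have [y _ ey] := up _ S2.
  rewrite leqNgt; apply/negP => ju; move: zj.
  rewrite -ex -ey /= !(nth_append (x 0))//.
  by rewrite eqxx.
have [k /asboolP[p [pp pk]] kmax] := ex_maxnP exP KP.
exists p; split=> // q qp; rewrite pk; apply: kmax.
by apply/asboolP; exists q.
Qed.

Lemma thetaP (h : homeo cantorr) nu : 1 < n -> is_lcp (h @` cone nu) (theta h nu).
Proof.
move=> n1; rewrite /theta; case: xgetP => [p -> //|no].
pose a : cantor := fun _ => Ordinal (ltnW n1).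
pose b : cantor := fun _ => Ordinal n1.
have [||ab|p /no//] := @lcp_exists (h @` cone nu) (h (point nu a)) (h (point nu b)).
- by exists (point nu a) => //; exists a.
- by exists (point nu b) => //; exists b.
- have [e] := can_inj (@hfunK _ h) ab.
  have := congr1 (fun f => f (size nu.2 + 0)) e.
  by rewrite !append_shift.
Qed.

Lemma local_action_inl (h : homeo cantorr) nu f : 1 < n ->
  local_action h nu = inl f ->
  exists2 u, theta h nu = Some u &
             forall x, h (point nu x) = point u (f x).
Proof.
move=> n1; have := thetaP h nu n1; rewrite /local_action.
case: (theta h nu) => [u|//] [up _] [<-]; exists u => // x.
have [|y _ ey] := up (h (point nu x)).
  by exists (point nu x) => //; exists x.
rewrite -ey /point /=; congr (_, append _ _).
by apply/funext => i; rewrite append_shift.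
Qed.

Lemma local_action_inr (h : homeo cantorr) nu f :
  local_action h nu = inr f -> forall x, h (point nu x) = f x.
Proof. by rewrite /local_action; case: theta => // -[<-]. Qed.

End CantorSpaces.

(* Main.v *)
(** Fix c, a, b. Some g in G_{n,r} satisfies (cabx)g = cax for all x, and
    varphi^-1 g varphi, being in G_{n,r}, replaces prefixes along a complete
    antichain. By compactness varphi maps U_{cabs} into a single cone of that
    antichain once s is long enough, and the local actions of varphi at cabs and
    at cas then agree. As there are finitely many triples (c, a, b), one bound on
    s serves them all, so deleting the second letter shows that every local action
    of varphi is attained at a word of bounded length. *)

Require Import Defs.
From mathcomp Require Import all_boot.
From mathcomp Require Import all_classical topology.
(* [point] is shadowed by the one of pointed types. *)
Import Defs.

Set Implicit Arguments.
Unset Strict Implicit.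
Unset Printing Implicit Defensive.

Local Open Scope classical_set_scope.

(* Brouwer's fan theorem. *)
Lemma fan_bound (n : nat) (P : seq 'I_n -> Prop) :
  (forall s t, P s -> P (s ++ t)) ->
  (forall x : nat -> 'I_n, exists k, P (mkseq x k)) ->
  exists K, forall s, K <= size s -> P s.
Proof.
move=> Pcat Pbar; apply: contrapT => no.
(* A node is bad when no single bound serves all its extensions. A bad root would start an infinite
   branch of bad nodes, and some node on that branch satisfies [P]. *)
pose bad s := ~ exists K, forall t, K <= size t -> P (s ++ t).
have badS s : bad s -> exists a, bad (rcons s a).
  move=> bs; apply: contrapT => /forallNP ok; apply: bs.
  have /choice[K KP] : forall a, exists K, forall t,
      K <= size t -> P (rcons s a ++ t).
    by move=> a; exact: contrapT (ok a).
  (* The maximum is over a finite alphabet; the successor pays for the letter [a]. *)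
  exists (\max_a K a).+1 => -[|a t] //=; rewrite ltnS => le_t.
  by rewrite -cat_rcons; apply: KP; exact: leq_trans (leq_bigmax a) le_t.
have [a0 _] : exists a, bad (rcons [::] a) by exact: badS.
have /choice[f fP] : forall s, exists a, bad s -> bad (rcons s a).
  by move=> s; have [/badS[a]|] := pselect (bad s); [exists a|exists a0].
pose p k := iter k (fun s => rcons s (f s)) [::].
have [k] := Pbar (f \o p).
have -> : mkseq (f \o p) k = p k.
  by elim: k => [|k IH] //; rewrite mkseqS IH.
have : bad (p k) by elim: k => [|k IH] //=; exact: fP.
by move=> + Pk; apply; exists 0 => t _; exact: Pcat.
Qed.

(** * Words as prefixes of points, cones as a basis of the topology, complete antichains *)

Section Words.
Variables n r : nat.
Implicit Types (u v w : word n r) (z : cantorr n r) (x y : cantor n).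
Implicit Types s t : seq 'I_n.

Definition cat_word u s : word n r := (u.1, u.2 ++ s).

Definition take_point z k : word n r := (z.1, mkseq z.2 k).

Lemma append_cat s t x : append (s ++ t) x = append s (append t x).
Proof.
apply/funext => i; rewrite /append size_cat nth_cat.
have [si|si] := ltnP i (size s); first exact: set_nth_default.
by rewrite [RHS]nth_default// subnDA.
Qed.

Lemma point_cat u s x : point (cat_word u s) x = point u (append s x).
Proof. by rewrite /point append_cat. Qed.

Lemma append_mkseq (x y : cantor n) k i :
  i < k -> append (mkseq x k) y i = x i.
Proof. by move=> ik; rewrite /append nth_mkseq. Qed.

Lemma mkseq_append s x : mkseq (append s x) (size s) = s.
Proof.
apply: (@eq_from_nth _ (x 0)) => [|i]; rewrite size_mkseq// => si.
by rewrite nth_mkseq// (nth_append (x 0)).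
Qed.

Lemma append_mkseqK x k : append (mkseq x k) (fun i => x (k + i)) = x.
Proof.
apply/funext => i; have [ik|ki] := ltnP i k; first exact: append_mkseq.
by rewrite /append nth_default size_mkseq// subnKC.
Qed.

Lemma append_inj s : injective (append s).
Proof.
move=> x y /(congr1 (fun f => fun i => f (size s + i))) e.
by apply/funext => i; have := congr1 (@^~ i) e; rewrite /= !append_shift.
Qed.

Lemma coneP u z : cone u z <-> take_point z (size u.2) = u.
Proof.
split=> [[x _ <-]|].
  by case: u => c s; rewrite /take_point /= mkseq_append.
case: z => c x <-; rewrite /take_point /= ?size_mkseq.
by exists (fun i => x (size u.2 + i)) => //; rewrite /point /= append_mkseqK.
Qed.

Lemma wprefix_take_point v z k :
  size v.2 <= k -> wprefix v (take_point z k) -> cone v z.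
Proof.
case: v => c s /= sk /andP[/eqP/= -> /prefixP[t /= e]]; apply/coneP.
have es : take (size s) (mkseq z.2 k) = s by rewrite e take_size_cat.
rewrite /take_point /=; congr (_, _); rewrite -[RHS]es.
by rewrite /mkseq -map_take take_iota (minn_idPl sk).
Qed.

Lemma cone_comparable u v z : cone u z -> cone v z -> size u.2 <= size v.2 ->
  exists s, v = cat_word u s.
Proof.
case: u => c s /coneP[<- es] /coneP <-; rewrite size_mkseq /= => sv.
exists [seq z.2 i | i <- iota (size s) (size v.2 - size s)].
rewrite /cat_word /take_point /= -[in RHS]es -(subnKC sv).
by rewrite size_mkseq addKn /mkseq iotaD map_cat.
Qed.

(** Otherwise a prefix of [z] longer than every word of [A] would be incomparable with all of them
    and could be added to [A], against maximality. *)
Lemma complete_antichain_cover (A : set (word n r)) z :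
  complete_antichain A -> exists2 v, A v & cone v z.
Proof.
case=> /finite_seqP[l Al] anti maxA; apply: contrapT => no.
have notin v : A v -> ~ cone v z by move=> Av vz; apply: no; exists v.
pose N := (\max_(v <- l) size v.2).+1.
have ltN v : A v -> size v.2 < N.
  by rewrite Al ltnS => vl; exact: (leq_bigmax_seq (F := fun v => size v.2) v).
pose w := take_point z N.
have incomp v : A v -> ~~ wprefix v w /\ ~~ wprefix w v.
  move=> Av; split; apply/negP.
    by move/(wprefix_take_point (ltnW (ltN _ Av))); exact: notin.
  move=> /andP[_ /size_prefix]; rewrite size_mkseq leqNgt.
  by rewrite ltN.
suff : A w by move=> /ltN; rewrite size_mkseq ltnn.
rewrite -(maxA (A `|` [set w])); [by right| |by left].
move=> u v [Au|->] [Av|->] //; first exact: anti.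
  by move=> _; case: (incomp _ Au).
by move=> _; case: (incomp _ Av).
Qed.

Lemma complete_antichainI (A : set (word n r)) :
  finite_set A -> antichain A ->
  (forall u, exists2 v, A v & wprefix u v || wprefix v u) ->
  complete_antichain A.
Proof.
move=> finA anti comp; split=> // B antiB AB; apply/seteqP; split=> // u Bu.
have [v Av uv] := comp u; have [<-//|] := pselect (v = u).
move=> ne; move: uv; rewrite (negPf (antiB _ _ (AB _ Av) Bu ne)) orbF.
by rewrite (negPf (antiB _ _ Bu (AB _ Av) (nesym ne))).
Qed.

Lemma near_cone u z : cone u z -> \forall w \near z, cone u w.
Proof.
move=> /coneP uz.
have near1 : \forall w \near z, w.1 = z.1.
  exact: (@cvg_fst _ _ (nbhs z.1) (nbhs z.2) _ _ (discrete_set1 _)).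
have near2 k : \forall w \near z, mkseq w.2 k = mkseq z.2 k.
  elim: k => [|k IH]; first exact: filterE.
  have nk : \forall w \near z, w.2 k = z.2 k.
    apply: (@cvg_snd _ _ (nbhs z.1) (nbhs z.2) _ [set x | x k = z.2 k]).
    exact: (@proj_continuous _ (fun _ => discrete_topology 'I_n) k z.2 [set z.2 k]
      (discrete_set1 _)).
  by apply: filterS2 IH nk => w; rewrite !mkseqS => -> ->.
apply: filterS2 near1 (near2 (size u.2)) => w w1 w2.
by apply/coneP; rewrite /take_point w1 w2.
Qed.

(** Otherwise points outside [A] sharing ever longer prefixes with [z] would converge to [z]: each
    coordinate is eventually constant. *)
Lemma nbhs_cone z (A : set (cantorr n r)) : nbhs z A ->
  exists k, cone (take_point z k) `<=` A.
Proof.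
case=> -[B C] [/= zB zC] BCA; apply: contrapT => /forallNP no.
have /choice[y yA] : forall k, exists y, ~ A (point (take_point z k) y).
  move=> k; apply: contrapT => /forallNP Ay; apply: (no k) => _ [y _ <-].
  exact: contrapT (Ay y).
have : (fun k => append (mkseq z.2 k) (y k)) @ \oo --> z.2.
  apply: (pointwise_cvgP (V := discrete_topology 'I_n) z.2 _).2 => i.
  apply: cvg_near_cst.
  by apply: filterS (nbhs_infty_gt i) => k; exact: append_mkseq.
move=> /(_ _ zC)[k _ /(_ k (leqnn k)) Ck]; apply: (yA k); apply: BCA.
by split=> //; exact: nbhs_singleton.
Qed.

(** On the left the [k] letters come after [u], on the right the letters of [u] count among the [k],
    so the left word extends the right one. *)
Lemma cone_mkseq u x k :
  cone (cat_word u (mkseq x k)) `<=` cone (take_point (point u x) k).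
Proof.
move=> _ [y _ <-]; rewrite point_cat; apply/coneP.
rewrite /take_point size_mkseq /=; congr (_, _).
apply/eq_in_map => i; rewrite mem_iota add0n /append => /andP[_ ik].
case: (ltnP i (size u.2)) => iu; first exact: set_nth_default.
rewrite !(nth_default _ iu) nth_mkseq//.
exact: leq_ltn_trans (leq_subr _ _) ik.
Qed.

(** The right-hand side does not mention [u], so common prefixes can be carried from one [u] to
    another. *)
Lemma cone_cat_point u s x :
  cone (cat_word u s) (point u x) <-> range (append s) x.
Proof.
split=> [[y _]|[y _ <-]]; last by exists y => //; rewrite point_cat.
by rewrite point_cat => -[/append_inj <-]; exists y.
Qed.

(** Two prefixes of the same point are comparable. *)
Lemma antichain_disjoint (A : set (word n r)) u v z :
  antichain A -> A u -> A v -> cone u z -> cone v z -> u = v.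
Proof.
move=> anti; wlog uv : u v / size u.2 <= size v.2.
  move=> H Au Av uz vz; case/orP: (leq_total (size u.2) (size v.2)) => uv.
    exact: H.
  exact/esym/H.
move=> Au Av uz vz; apply: contrapT => /(anti _ _ Au Av).
have [s ->] := cone_comparable uz vz uv.
by rewrite /wprefix /= eqxx prefix_prefix.
Qed.

Lemma finite_words k : finite_set [set w : word n r | size w.2 <= k].
Proof.
apply: (@sub_finite_set _ _
  (range (fun p : 'I_r * k.-bseq 'I_n => (p.1, p.2 : seq 'I_n)))).
  by move=> [c s] /= sk; exists (c, Bseq sk).
by apply: finite_image; exact: finite_finset.
Qed.

End Words.

(** * Elements of G_{n,r} built from bijections between complete antichains *)

Section PrefixExchange.
Variables n r : nat.
Implicit Types (A B : set (word n r)) (sigma tau : word n r -> word n r).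

(** The cones of [A] partition the space, so replacing prefixes is well defined; they are open, so
    continuity can be checked on each of them. *)
Lemma prefix_map_continuous A sigma : complete_antichain A ->
  exists2 f : cantorr n r -> cantorr n r, continuous f &
    forall u x, A u -> f (point u x) = point (sigma u) x.
Proof.
move=> cA; have [_ antiA _] := cA.
have /choice[f fP] : forall z, exists z', forall u x,
    A u -> z = point u x -> z' = point (sigma u) x.
  move=> z; have [u Au [x _ xz]] := complete_antichain_cover z cA.
  exists (point (sigma u) x) => v y Av yz.
  have uv : u = v.
    by apply: (antichain_disjoint (z := z) antiA Au Av); [exists x|exists y].
  by subst v; move: xz; rewrite yz => -[/append_inj ->].
exists f => [z|u x Au]; last exact: (fP _ u x).
have [u Au [x _ xz]] := complete_antichain_cover z cA.
have fu y : f (point u y) = point (sigma u) y by exact: (fP _ u y).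
rewrite -xz /continuous_at fu => C /nbhs_cone[k kC].
have /near_cone : cone (cat_word u (mkseq x k)) (point u x).
  apply/cone_cat_point; exists (fun i => x (k + i)) => //.
  exact: append_mkseqK.
apply: filterS => _ [y _ <-]; rewrite point_cat; apply: kC.
by rewrite fu -point_cat; apply: cone_mkseq; exists y.
Qed.

Lemma prefix_exchange A B sigma tau :
  complete_antichain A -> complete_antichain B ->
  (forall u, A u -> B (sigma u) /\ tau (sigma u) = u) ->
  (forall v, B v -> A (tau v) /\ sigma (tau v) = v) ->
  exists2 g : homeo (cantorr n r), higman_thompson g &
    forall u x, A u -> g (point u x) = point (sigma u) x.
Proof.
move=> cA cB sigmaK tauK.
have [f fc fE] := prefix_map_continuous sigma cA.
have [g gc gE] := prefix_map_continuous tau cB.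
have fK : cancel f g.
  move=> z; have [u Au [x _ <-]] := complete_antichain_cover z cA.
  by have [Bu uK] := sigmaK _ Au; rewrite fE// gE// uK.
have gK : cancel g f.
  move=> z; have [u Bu [x _ <-]] := complete_antichain_cover z cB.
  by have [Au uK] := tauK _ Bu; rewrite gE// fE// uK.
exists (Homeo fK gK fc gc) => //=.
have [/finite_seqP[l Al] _ _] := cA.
(* Repetitions are removed because [higman_thompson] asks for an injective indexing by an
   ordinal. *)
have AE u : A u <-> u \in undup l by rewrite mem_undup Al.
pose eta := tnth (in_tuple (undup l)).
have etaA i : A (eta i) by apply/AE; exact: mem_tnth.
have eta_inj : injective eta by apply/tuple_uniqP; exact: undup_uniq.
have rangeA : range eta = A.
  apply/seteqP; split=> [_ [i _ <-]//|u /AE/(tnthP (in_tuple _))[i ->]].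
  by exists i.
exists (size (undup l)), eta, (sigma \o eta); split=> //.
- move=> i j /= /(congr1 tau).
  by rewrite !(sigmaK _ (etaA _)).2; exact: eta_inj.
- by rewrite rangeA.
- suff -> : range (sigma \o eta) = B by [].
  apply/seteqP; split=> [_ [i _ <-]|v /tauK[+ <-]].
    by case: (sigmaK _ (etaA i)).
  by rewrite -[in A _]rangeA => -[i _ <-]; exists i.
- by move=> i x /=; rewrite fE.
Qed.

(* The complete antichain got from the one-letter words by expanding c, then ca. *)
Definition split2 (c : 'I_r) (a : 'I_n) : set (word n r) :=
  [set w | if w.1 == c then
     match w.2 with [:: e] => e != a | [:: e; _] => e == a | _ => false end
   else w.2 == [::]].

Lemma split2_complete c a : complete_antichain (split2 c a).
Proof.
apply: complete_antichainI.
- apply: sub_finite_set (finite_words n r 2) => -[d s]; rewrite /split2 /=.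
  by case: ifP => _; [case: s => [|e [|f [|]]]|move/eqP ->].
- move=> [d s] [d' s']; rewrite /split2 /wprefix /= => ds ds' ne.
  apply/negP => /andP[/eqP dd' ss']; apply: ne; subst d'; congr (_, _).
  move: ds ds' ss'; case: ifP => [_|_ /eqP-> /eqP->//].
  case: s => [|e [|f [|]]]//; case: s' => [|e' [|f' [|]]]//=;
    rewrite ?andbT ?andbF//.
  + by move=> _ _ /eqP->.
  + by move=> ea /eqP-> /eqP e'a; rewrite e'a eqxx in ea.
  + by move=> _ _ /andP[/eqP-> /eqP->].
- move=> [d s]; rewrite /split2 /wprefix.
  have [->|dc] := eqVneq d c; last first.
    by exists (d, [::]); rewrite /= ?(negPf dc)// eqxx prefix0s orbT.
  (* Both [c] and [ca] are proper prefixes of [caa], which belongs to the antichain. *)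
  case: s => [|e s]; first by exists (c, [:: a; a]); rewrite /= ?eqxx.
  have [->|ea] := eqVneq e a; last first.
    by exists (c, [:: e]); rewrite /= ?eqxx//= prefix0s orbT.
  case: s => [|f s]; first by exists (c, [:: a; a]); rewrite /= ?eqxx.
  by exists (c, [:: a; f]); rewrite /= ?eqxx//= prefix0s orbT.
Qed.

(** For [a != a'], a bijection from [split2 c a] to [split2 c a']: [cab] goes to [ca], the other
    [caf] go to [ca'f], and [ca'] fills the gap [ca'b]. Exchanging [a] and [a'] gives the
    inverse. *)
Definition swap2 (c : 'I_r) (a a' b : 'I_n) (w : word n r) : word n r :=
  if w.1 == c then
    match w.2 with
    | [:: e] => if e == a' then (c, [:: a'; b]) else w
    | [:: _; f] => if f == b then (c, [:: a]) else (c, [:: a'; f])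
    | _ => w
    end
  else w.

Lemma swap2K c a a' b w : a != a' -> split2 c a w ->
  split2 c a' (swap2 c a a' b w) /\ swap2 c a' a b (swap2 c a a' b w) = w.
Proof.
move=> aa'; case: w => d s; rewrite /split2 /swap2 /=.
have [->|dc] := eqVneq d c; last by rewrite /= (negPf dc).
case: s => [|e [|f [|]]]//.
- move=> ea; have [->|ea'] := eqVneq e a'; first by rewrite /= !eqxx.
  by rewrite /= eqxx ea' (negPf ea).
- move=> /eqP->; have [->|fb] := eqVneq f b; first by rewrite /= !eqxx aa'.
  by rewrite /= !eqxx (negPf fb).
Qed.

(** The word [cab] lies in [split2 c a], and [ca] lies in [split2 c a'] for any letter [a'] other
    than [a]; such a letter exists as [1 < n]. *)
Lemma higman_thompson_shift c a b : 1 < n ->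
  exists2 g : homeo (cantorr n r), higman_thompson g &
    forall x, g (point (c, [:: a; b]) x) = point (c, [:: a]) x.
Proof.
move=> n1; have [a' aa'] : exists a', a != a'.
  pose o0 := Ordinal (ltnW n1); pose o1 := Ordinal n1.
  by have [->|] := eqVneq a o0; [exists o1|exists o0].
have [||g Gg gE] := prefix_exchange (split2_complete c a) (split2_complete c a')
  (sigma := swap2 c a a' b) (tau := swap2 c a' a b).
- by move=> u; exact: swap2K.
- by move=> u; apply: swap2K; rewrite eq_sym.
exists g => // x; rewrite gE; last by rewrite /split2 /= !eqxx.
by rewrite /swap2 /= !eqxx.
Qed.

End PrefixExchange.

(** * Local actions at words with a common tail, and the finiteness theorem *)

Section LocalActions.
Variables n r : nat.
Implicit Types (h g : homeo (cantorr n r)) (u v nu mu : word n r).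

(** Along each infinite branch continuity gives a suitable prefix; the fan theorem makes its length
    uniform. *)
Lemma image_cone_bound h u (A : set (word n r)) : complete_antichain A ->
  exists K, forall s, K <= size s ->
    exists2 v, A v & forall x, cone v (h (point (cat_word u s) x)).
Proof.
move=> cA; apply: fan_bound => [s t [v Av sv]|x].
  by exists v => // x; rewrite point_cat append_cat -point_cat; exact: sv.
have [v Av hv] := complete_antichain_cover (h (point u x)) cA.
have [k kv] := nbhs_cone (@hfun_continuous _ h _ _ (near_cone hv)).
exists k, v => // y; apply: kv; apply: cone_mkseq.
by exists y.
Qed.

(** The longest common prefix extends [u], and the extension [s] depends on [Y] alone. *)
Lemma is_lcp_point (Y : set (cantor n)) u p : Y !=set0 ->
  is_lcp (point u @` Y) p ->
  exists2 s, p = Some (cat_word u s) &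
    forall v, is_lcp (point v @` Y) (Some (cat_word v s)).
Proof.
move=> [y0 Yy0] [pY pmax].
have : olength (Some u) <= olength p.
  by apply: pmax => _ [y _ <-]; exists y.
case: p pY pmax => [w|//] wY wmax; rewrite ltnS => uw.
have [s ws] : exists s, w = cat_word u s.
  apply: (@cone_comparable _ _ _ _ (point u y0)) uw; first by exists y0.
  by apply: wY; exists y0.
subst w; exists s => // v; split=> [_ [y Yy <-]|[q|//] qY].
  by apply/cone_cat_point/(cone_cat_point u)/wY; exists y.
(* A common prefix [q] no longer than [v] is within the bound. A longer one is [v] followed by some
   [t]; then [u] followed by [t] competes with the maximal prefix over [u]. *)
have [qv|vq] := leqP (size q.2) (size v.2).
  by rewrite ltnS size_cat (leq_trans qv)// leq_addr.
have [t qt] : exists t, q = cat_word v t.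
  apply: (@cone_comparable _ _ _ _ (point v y0)) (ltnW vq); first by exists y0.
  by apply: qY; exists y0.
subst q; have := wmax (Some (cat_word u t)).
rewrite /= !size_cat !ltnS !leq_add2l; apply => _ [y Yy <-].
by apply/cone_cat_point/(cone_cat_point v)/qY; exists y.
Qed.

(** Both images have the form prefix times [range y], so the same [s] is absorbed into both values
    of [theta], and deleting them leaves the same tail of [y]. *)
Lemma eq_local_action h nu mu u v (y : cantor n -> cantor n) : 1 < n ->
  (forall x, h (point nu x) = point u (y x)) ->
  (forall x, h (point mu x) = point v (y x)) ->
  local_action h nu = local_action h mu.
Proof.
move=> n1 hnu hmu.
have imE w w' : (forall x, h (point w x) = point w' (y x)) ->
    h @` cone w = point w' @` range y.
  move=> hw; rewrite !image_comp.
  by apply/seteqP; split=> _ [x _ <-]; exists x => //=; rewrite hw.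
have Y0 : range y !=set0 by exists (y (fun=> Ordinal n1)), (fun=> Ordinal n1).
have := thetaP h nu n1; rewrite (imE _ _ hnu) => /(is_lcp_point Y0)[s tnu slcp].
have tmu : theta h mu = Some (cat_word v s).
  apply: lcp_uniq (thetaP h mu n1) _; last by rewrite (imE _ _ hmu).
  by rewrite (imE _ _ hmu); case: Y0 => z Yz; exists (point v z), z.
rewrite /local_action tnu tmu; congr inl; apply/funext => x; apply/funext => i.
by rewrite hnu hmu /= !size_cat -!addnA !append_shift.
Qed.

(** For long [s], [h] maps the cone of [us] into one cone [eta i], where [g'] only replaces the
    prefix by [zeta i]. Hence [h] at [us] and at [vs] has the same tails [y]. *)
Lemma local_action_conj h g g' u v : 1 < n -> higman_thompson g' ->
  (forall z, g' (h z) = h (g z)) ->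
  (forall x, g (point u x) = point v x) ->
  exists K, forall s, K <= size s ->
    local_action h (cat_word u s) = local_action h (cat_word v s).
Proof.
move=> n1 [k [eta [zeta [_ _ ceta _ g'E]]]] g'h guv.
have [K KP] := image_cone_bound h u ceta.
exists K => s /KP[_ [i _ <-] hs].
have /choice[y yE] : forall x, exists y,
    h (point (cat_word u s) x) = point (eta i) y.
  by move=> x; have [y _ <-] := hs x; exists y.
apply: (eq_local_action (v := zeta i) n1 yE) => x.
by rewrite -g'E -yE g'h !point_cat guv.
Qed.

End LocalActions.

Theorem theorem6p1 (n r : nat) (hr : 1 <= r) (hrn : r < n)
    (phi : homeo (cantorr n r) -> homeo (cantorr n r))
    (hphi : automorphism (@higman_thompson n r) phi)
    (varphi : homeo (cantorr n r)) (hvarphi : rubin_conjugator phi varphi) :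
  finite_set (local_actions varphi).
Proof.
have n1 : 1 < n by exact: leq_ltn_trans hr hrn.
have /choice[K KP] : forall p : 'I_r * 'I_n * 'I_n, exists K, forall s,
    K <= size s ->
    local_action varphi (p.1.1, [:: p.1.2, p.2 & s]) =
    local_action varphi (p.1.1, p.1.2 :: s).
  move=> [[c a] b]; have [g Gg gE] := higman_thompson_shift c a b n1.
  have [[phiG _ _] _] := hphi.
  (* The conjugate [phi g] is in G_{n,r} because [phi] preserves that group. *)
  apply: local_action_conj n1 (phiG _ Gg) _ gE => z.
  by rewrite (hvarphi _ Gg) /= hfunK.
pose N := \max_p K p.
have short c a s : exists2 t, size t <= N &
    local_action varphi (c, a :: s) = local_action varphi (c, a :: t).
  elim: s => [|b s [t tN IH]]; first by exists [::].
  have [sN|Ns] := leqP (size s).+1 N; first by exists (b :: s).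
  (* Here [size s] is at least [N], hence at least [K (c, a, b)], so [b] can be deleted. *)
  exists t => //; rewrite -IH; apply: (KP (c, a, b)).
  by rewrite -ltnS; apply: leq_ltn_trans Ns; exact: leq_bigmax.
(* The value [id] is a default for local actions into [cantorr]; the bound [N.+1] counts the first
   letter [a], which is never deleted. *)
apply: sub_finite_set (finite_image
  (fun w => if local_action varphi w is inl f then f else id)
  (finite_words n r N.+1)).
move=> f [[c [//|a s]] _ fE]; have [t tN st] := short c a s.
by exists (c, a :: t) => //; rewrite -st fE.
Qed.
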